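(* Let $m$ be a positive integer, and let $G$ and $w(\cdot)$ be the group and the word associated with $m$ as defined in the context. If two chord diagrams with a base point $c_1, c_2$ are equivalent (i.e. represent the same long free knot, meaning that they are connected by a finite sequence of first, second and third Reidemeister moves), then $$w(c_1)=w(c_2)\quad\text{in } G.$$
   Context: **Chord diagrams.** A chord diagram (with a base point) is an unordered partition $a=\{(p_1,q_1),\dots,(p_n,q_n)\}$ of $\{1,2,\dots,2n\}$ into $n$ unordered two-element sets ($n\ge 0$; for $n=0$ the diagram is empty). Each pair is called a chord, and its two elements are the ends of the chord. Two chords $(p_i,q_i),(p_j,q_j)$ are linked if $(p_i-p_j)(p_i-q_j)(q_i-p_j)(q_i-q_j)<0$, and unlinked otherwise. For a set of chords $b$ and a chord $p$, $g(p,b)$ denotes the number of chords in $b$ linked with $p$ (a chord is not linked with itself). **Classes of chords.** Fix a positive integer $m$. For a chord diagram $a$, put $a_0=\{p\in a : g(p,a)\text{ is odd}\}$ and, inductively for $1\le k\le m-1$, $$a_k=\Big\{p\in a\setminus\bigcup_{i<k}a_i \;:\; g\Big(p,a\setminus\bigcup_{i<k}a_i\Big)\text{ is odd}\Big\}.$$ Put $a_m=a\setminus\bigcup_{j=0}^{m-1}a_j$. For $0\le k\le m-1$ split $a_k=a'_k\sqcup a''_k$, where $a'_k=\{p\in a_k : g(p,a_k)\text{ is odd}\}$ and $a''_k=a_k\setminus a'_k$. Thus every chord belongs to exactly one of the subsets $a'_0,a''_0,\dots,a'_{m-1},a''_{m-1},a_m$. **The group $G$.** Let $D=\{a'_0,a''_0,a'_1,a''_1,\dots,a'_{m-1},a''_{m-1},a_m\}$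 be regarded as a set of $2m+1$ formal letters. $G$ (depending on $m$) is the group generated by $D$ with the relations - $a'_ia'_i=e$ and $a''_ia''_i=e$ for $0\le i\le m-1$, and $a_ma_m=e$; - $a''_ia'_j=a'_ja'_i$ and $a''_ia''_j=a''_ja'_i$ for $0\le i<j\le m-1$; - $a'_ia_m=a_ma''_i$ for $0\le i<m$. **The word $w(c)$.** For a chord diagram $c$ with $n$ chords, $w(c)$ is the word of length $2n$ in the alphabet $D$ whose $k$-th letter ($1\le k\le 2n$) is the letter naming the class (among $a'_0,a''_0,\dots,a'_{m-1},a''_{m-1},a_m$, computed for $c$) that contains the chord having $k$ as an end. It is regarded as an element of $G$ (the empty word is $e$). **Reidemeister moves.** - First move: addition to, or removal from, a chord diagram of a chord $(p,q)$ with $|p-q|=1$. - Second move: addition or removal of a pair of adjacent chords. Two chords $(p_i,q_i),(p_j,q_j)$ are adjacent if $|\min(p_i,q_i)-\min(p_j,q_j)|=|\max(p_i,q_i)-\max(p_j,q_j)|=1$. - In the first and second moves the ends of the remaining chords are renumbered accordingly, in the order-preserving way, so that the ends of the resulting diagram are again $1,\dots,2n'$. - Third move: three chords of a diagram form a completely adjoint triple $T$ if their six ends can be partitioned into three pairs such that each pair consists of ends of two different chords and the two numbers in each pair differ by one. The set of the six ends is then $S=\{r,r+1,s,s+1,t,t+1\}$, where $\{r,r+1\},\{s,s+1\},\{t,t+1\}$ are these pairs. Let $f:S\to S$ be the involution $r\leftrightarrow r+1$, $s\leftrightarrow s+1$, $t\leftrightarrow t+1$. Let $T'$ be the triple of chords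 with the same set $S$ of ends, in which $u,v\in S$ form a chord if and only if $f(u),f(v)$ form a chord of $T$. The third move replaces $T$ by $T'$ and leaves all other chords fixed. **Long free knots.** A long free knot is an equivalence class of chord diagrams with a base point under the equivalence relation generated by these three moves. *)

(* Defs.v *)
From HB Require Import structures.
From mathcomp Require Import all_boot all_order all_algebra all_fingroup.
From mathcomp Require Import generic_quotient boolp.
From Stdlib Require Import Relation_Operators.

Set Implicit Arguments.
Unset Strict Implicit.
Unset Printing Implicit Defensive.

Import GRing.Theory Num.Theory.

Section Presentation.

Variables (X : choiceType) (R : seq X -> seq X -> Prop).

(* Words in the generators and their formal inverses: (x, false) stands for x *)
(* and (x, true) for x^-1.                                                    *)
Definition signed_word := seq (X * bool).

Definition pos_word (s : seq X) : signed_word := [seq (x, false) | x <- s].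

Definition inv_word (u : signed_word) : signed_word :=
  rev [seq (xb.1, ~~ xb.2) | xb <- u].

Inductive pres_eq : signed_word -> signed_word -> Prop :=
| pres_rel s t : R s t -> pres_eq (pos_word s) (pos_word t)
| pres_cancel x b : pres_eq [:: (x, b); (x, ~~ b)] [::]
| pres_cat u u' v v' : pres_eq u u' -> pres_eq v v' -> pres_eq (u ++ v) (u' ++ v')
| pres_refl u : pres_eq u u
| pres_sym u v : pres_eq u v -> pres_eq v u
| pres_trans u v w : pres_eq u v -> pres_eq v w -> pres_eq u w.

Definition pres_eqb (u v : signed_word) : bool := `[< pres_eq u v >].

Lemma pres_eqb_refl : reflexive pres_eqb.
Proof. by move=> u; apply/asboolP; apply: pres_refl. Qed.

Lemma pres_eqb_sym : symmetric pres_eqb.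
Proof.
by move=> u v; apply/asboolP/asboolP; apply: pres_sym.
Qed.

Lemma pres_eqb_trans : transitive pres_eqb.
Proof.
move=> v u w /asboolP huv /asboolP hvw; apply/asboolP; exact: pres_trans huv hvw.
Qed.

Canonical pres_equiv := EquivRel pres_eqb pres_eqb_refl pres_eqb_sym pres_eqb_trans.

Lemma inv_word_cancel u : pres_eq (inv_word u ++ u) [::].
Proof.
elim: u => [|[x b] u IHu]; first exact: pres_refl.
rewrite /inv_word /= rev_cons cat_rcons -cat1s -[(x, b) :: u]cat1s.
apply: pres_trans IHu; apply: pres_cat; first exact: pres_refl.
rewrite catA -[X in pres_eq _ X]cat0s; apply: pres_cat; last exact: pres_refl.
by rewrite /= -{2}[b]negbK; apply: pres_cancel.
Qed.

Lemma inv_wordK : involutive inv_word.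
Proof.
move=> u; rewrite /inv_word map_rev revK -map_comp -[RHS]map_id.
by apply: eq_map => -[x b] /=; rewrite negbK.
Qed.

Lemma inv_word_eq u v : pres_eq u v -> pres_eq (inv_word u) (inv_word v).
Proof.
move=> huv.
have h1 : pres_eq (inv_word u ++ u ++ inv_word v) (inv_word u).
  rewrite -[X in pres_eq _ X]cats0; apply: pres_cat; first exact: pres_refl.
  apply: (pres_trans (v := v ++ inv_word v)).
    by apply: pres_cat => //; apply: pres_refl.
  by rewrite -{1}[v]inv_wordK; apply: inv_word_cancel.
apply: pres_trans (pres_sym h1) _; rewrite catA.
rewrite -[X in pres_eq _ X]cat0s; apply: pres_cat; last exact: pres_refl.
exact: inv_word_cancel.
Qed.

Definition presented_group := {eq_quot pres_equiv}%qT.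

HB.instance Definition _ := Choice.on presented_group.

Definition pres_pi (u : signed_word) : presented_group := (\pi_({eq_quot pres_equiv}) u)%qT.

Definition pres_repr (x : presented_group) : signed_word :=
  repr (x : {eq_quot pres_equiv}%qT).

Lemma pres_piP u v : pres_pi u = pres_pi v <-> pres_eq u v.
Proof.
split=> [/eqmodP/asboolP //|huv].
by apply/eqmodP/asboolP.
Qed.

Lemma pres_reprK : cancel pres_repr pres_pi.
Proof. by move=> x; apply: reprK. Qed.

Definition pres_mul (x y : presented_group) : presented_group :=
  pres_pi (pres_repr x ++ pres_repr y).

Definition pres_inv (x : presented_group) : presented_group :=
  pres_pi (inv_word (pres_repr x)).

Lemma pres_mulE u v : pres_mul (pres_pi u) (pres_pi v) = pres_pi (u ++ v).
Proof. by apply/pres_piP/pres_cat; apply/pres_piP; rewrite pres_reprK. Qed.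

Lemma pres_invE u : pres_inv (pres_pi u) = pres_pi (inv_word u).
Proof. by apply/pres_piP/inv_word_eq/pres_piP; rewrite pres_reprK. Qed.

Lemma pres_mulA : associative pres_mul.
Proof.
move=> x y z; rewrite -[x]pres_reprK -[y]pres_reprK -[z]pres_reprK.
by rewrite !pres_mulE catA.
Qed.

Lemma pres_mul1g : left_id (pres_pi [::]) pres_mul.
Proof. by move=> x; rewrite -[x]pres_reprK pres_mulE. Qed.

Lemma pres_mulg1 : right_id (pres_pi [::]) pres_mul.
Proof. by move=> x; rewrite -[x]pres_reprK pres_mulE cats0. Qed.

Lemma pres_mulVg : left_inverse (pres_pi [::]) pres_inv pres_mul.
Proof.
move=> x; rewrite -[x]pres_reprK pres_invE pres_mulE.
exact/pres_piP/inv_word_cancel.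
Qed.

Lemma pres_mulgV : right_inverse (pres_pi [::]) pres_inv pres_mul.
Proof.
move=> x; rewrite -[x]pres_reprK pres_invE pres_mulE -{1}[pres_repr x]inv_wordK.
exact/pres_piP/inv_word_cancel.
Qed.

HB.instance Definition _ := isGroup.Build presented_group
  pres_mulA pres_mul1g pres_mulg1 pres_mulVg pres_mulgV.

Definition pres_gen (x : X) : presented_group := pres_pi [:: (x, false)].

Definition pres_eval (s : seq X) : presented_group :=
  (\prod_(x <- s) pres_gen x)%g.

Lemma pres_evalE s : pres_eval s = pres_pi (pos_word s).
Proof.
rewrite /pres_eval; elim: s => [|x s IHs]; first by rewrite big_nil.
by rewrite big_cons IHs; apply: pres_mulE.
Qed.

End Presentation.

Inductive letter (m : nat) : Type :=
| Prime of 'I_m          (* a'_i  *)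
| DoublePrime of 'I_m    (* a''_i *)
| Top.                   (* a_m   *)
Arguments Top {m}.

Definition letter_encode m (l : letter m) : option ('I_m * bool) :=
  match l with
  | Prime i => Some (i, false) | DoublePrime i => Some (i, true) | Top => None
  end.

Definition letter_decode m (x : option ('I_m * bool)) : letter m :=
  if x is Some (i, b) then if b then DoublePrime i else Prime i else Top.

Lemma letter_encodeK m : cancel (@letter_encode m) (@letter_decode m).
Proof. by case. Qed.

HB.instance Definition _ m := Finite.copy (letter m) (can_type (@letter_encodeK m)).

Inductive G_rel (m : nat) : seq (letter m) -> seq (letter m) -> Prop :=
| G_rel_PP i : G_rel [:: Prime i; Prime i] [::]
| G_rel_SS i : G_rel [:: DoublePrime i; DoublePrime i] [::]
| G_rel_TT : G_rel [:: Top; Top] [::]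
| G_rel_SP (i j : 'I_m) : i < j ->
    G_rel [:: DoublePrime i; Prime j] [:: Prime j; Prime i]
| G_rel_SS' (i j : 'I_m) : i < j ->
    G_rel [:: DoublePrime i; DoublePrime j] [:: DoublePrime j; Prime i]
| G_rel_PT i : G_rel [:: Prime i; Top] [:: Top; DoublePrime i].

Definition G (m : nat) := presented_group (@G_rel m).

HB.instance Definition _ m := Group.on (G m).

(* The ends are 0, ..., N - 1 instead of 1, ..., N; only differences and the  *)
(* order of ends are used below.                                              *)
Notation chord N := {set 'I_N}.

Section Classes.

Variable N : nat.
Implicit Types (p q : chord N) (a b : {set chord N}).

Definition linked p q : bool :=
  (\prod_(x in p) \prod_(y in q) (x%:Z - y%:Z) < 0)%R.

Lemma linkedE (x y z t : 'I_N) : x != y -> z != t ->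
  linked [set x; y] [set z; t] =
  ((x%:Z - z%:Z) * (x%:Z - t%:Z) * (y%:Z - z%:Z) * (y%:Z - t%:Z) < 0)%R.
Proof.
move=> nxy nzt; rewrite /linked.
have big2 (F : 'I_N -> int) (u v : 'I_N) : u != v ->
    (\prod_(i in [set u; v]) F i = F u * F v)%R.
  by move=> nuv; rewrite big_setU1 ?inE // big_set1.
by rewrite !big2 // !mulrA.
Qed.

Definition linking p b : nat := #|[set q in b | linked p q]|.

Definition odd_chords b : {set chord N} := [set p in b | odd (linking p b)].

(* rest a k is a with a_0, ..., a_(k-1) removed, see restE *)
Fixpoint rest a (k : nat) : {set chord N} :=
  if k is k'.+1 then rest a k' :\: odd_chords (rest a k') else a.

Definition layer a (k : nat) : {set chord N} := odd_chords (rest a k).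

Definition chord_class (m : nat) a (l : letter m) : {set chord N} :=
  match l with
  | Prime i => odd_chords (layer a i)
  | DoublePrime i => layer a i :\: odd_chords (layer a i)
  | Top => rest a m
  end.

(* The default value is never used when p \in a, see chord_class_unique       *)
Definition chord_letter (m : nat) a p : letter m :=
  odflt Top [pick l : letter m | p \in chord_class a l].

Lemma restE a k : rest a k = a :\: \bigcup_(i < k) layer a i.
Proof.
elim: k => [|k IHk] /=; first by rewrite big_ord0 setD0.
by rewrite big_ord_recr /= -setDDl -IHk.
Qed.

Lemma layer_sub_rest a k : layer a k \subset rest a k.
Proof. by apply/subsetP => p; rewrite inE => /andP[]. Qed.

Lemma odd_chords_sub b : odd_chords b \subset b.
Proof. by apply/subsetP => p; rewrite inE => /andP[]. Qed.

Lemma chord_class_sub_layer m a (i : 'I_m) p :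
  (p \in layer a i) =
  (p \in chord_class a (Prime i)) || (p \in chord_class a (DoublePrime i)).
Proof.
rewrite /= in_setD; case: (boolP (p \in odd_chords (layer a i))) => //= hp.
by rewrite (subsetP (odd_chords_sub _) _ hp).
Qed.

Lemma layer_disjoint a i j p : p \in layer a i -> p \in layer a j -> i = j.
Proof.
wlog hij : i j / i < j => [H hi hj|].
  by case: (ltngtP i j) => // h; [apply: H|apply/esym/H].
move=> hi /(subsetP (layer_sub_rest _ _)); rewrite restE inE => /andP[/bigcupP[]].
by exists (Ordinal hij).
Qed.

Lemma chord_class_unique m a p : p \in a ->
  exists! l : letter m, p \in chord_class a l.
Proof.
move=> pa; case: (boolP [exists i : 'I_m, p \in layer a i]) => [/existsP[i pi]|hN].
  have pNtop : p \notin rest a m.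
    by rewrite restE inE negb_and negbK; apply/orP; left; apply/bigcupP; exists i.
  have key l : p \in chord_class a l -> l = Prime i \/ l = DoublePrime i.
    case: l => [j|j|] /= hl.
    - have hj : p \in layer a j by apply: (subsetP (odd_chords_sub _)).
      by left; congr Prime; apply/val_inj/(layer_disjoint hj pi).
    - have hj : p \in layer a j by move: hl; rewrite inE => /andP[].
      by right; congr DoublePrime; apply/val_inj/(layer_disjoint hj pi).
    - by rewrite hl in pNtop.
  move: (pi); rewrite chord_class_sub_layer => /orP[h|h].
    exists (Prime i); split=> // l hl; case: (key l hl) => // el.
    by move: hl; rewrite el /= inE h.
  exists (DoublePrime i); split=> // l hl; case: (key l hl) => // el.
  by move: h; rewrite /= inE; move: hl; rewrite el /= => ->.
have hN' (i : 'I_m) : p \notin layer a i.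
  by apply: contra hN => h; apply/existsP; exists i.
exists Top; split=> [|[j|j|]] //=.
- rewrite restE inE pa andbT; apply/negP => /bigcupP[i _].
  by apply/negP/hN'.
- by move/(subsetP (odd_chords_sub _)); rewrite (negbTE (hN' j)).
- by rewrite inE (negbTE (hN' j)) andbF.
Qed.

Lemma chord_letterP m a p : p \in a -> p \in chord_class a (chord_letter m a p).
Proof.
move=> /(chord_class_unique m)[l [hl _]]; rewrite /chord_letter.
by case: pickP => [//|/(_ l)]; rewrite hl.
Qed.

End Classes.

Definition is_chord_diagram (N : nat) (a : {set chord N}) : bool :=
  partition a [set: 'I_N] && [forall p in a, #|p| == 2].

Record chord_diagram : Type := ChordDiagram {
  nchords : nat;
  chords : {set chord nchords.*2};
  chordsP : is_chord_diagram chords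
}.

Definition word (m : nat) (c : chord_diagram) : seq (letter m) :=
  [seq chord_letter m (chords c) (pblock (chords c) k) | k <- enum 'I_(nchords c).*2].

Definition w (m : nat) (c : chord_diagram) : G m := pres_eval (@G_rel m) (word m c).

(* c is obtained from c' by removing the chords in d and renumbering the      *)
(* remaining ends: f is the inverse of the renumbering.                       *)
Definition removal (c' : chord_diagram) (d : {set chord (nchords c').*2})
    (c : chord_diagram) : Prop :=
  d \subset chords c' /\
  exists f : 'I_(nchords c).*2 -> 'I_(nchords c').*2,
    {homo f : i j / i < j} /\
    chords c' :\: d = [set f @: (p : {set _}) | p in chords c].

(* The first two moves are stated as removals; additions are supplied by the  *)
(* symmetric closure in same_long_free_knot.                                  *)
Definition first_move (c' c : chord_diagram) : Prop :=
  exists p q : 'I_(nchords c').*2,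
    `|p%:Z - q%:Z|%R = 1%R /\ removal [set [set p; q]] c.

Definition adjacent_chords (N : nat) (b1 b2 : chord N) : Prop :=
  exists p1 q1 p2 q2 : 'I_N,
    [/\ b1 = [set p1; q1], b2 = [set p2; q2],
        `|(minn p1 q1)%:Z - (minn p2 q2)%:Z|%R = 1%R
      & `|(maxn p1 q1)%:Z - (maxn p2 q2)%:Z|%R = 1%R].

Definition second_move (c' c : chord_diagram) : Prop :=
  exists b1 b2 : chord (nchords c').*2,
    adjacent_chords b1 b2 /\ removal [set b1; b2] c.

(* x' is the end following x, and they are ends of different chords of T      *)
Definition end_pair (N : nat) (T : {set chord N}) (x x' : 'I_N) : Prop :=
  x' = x.+1 :> nat /\
  exists b b', [/\ b \in T, b' \in T, b != b', x \in b & x' \in b'].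

Inductive third_move : chord_diagram -> chord_diagram -> Prop :=
| ThirdMove n (a a' : {set chord n.*2})
    (ha : is_chord_diagram a) (ha' : is_chord_diagram a')
    (T : {set chord n.*2}) (r r' s s' t t' : 'I_n.*2) :
  let S := [set r; r'; s; s'; t; t'] in
  let f := (tperm r r' * tperm s s' * tperm t t')%g in
  let T' := [set [set u; v] | u in S, v in S & [set f u; f v] \in T] in
  T \subset a -> #|T| = 3 ->
  uniq [:: r; r'; s; s'; t; t'] -> cover T = S ->
  end_pair T r r' -> end_pair T s s' -> end_pair T t t' ->
  a' = (a :\: T) :|: T' ->
  third_move (ChordDiagram ha) (ChordDiagram ha').

Definition reidemeister (c c' : chord_diagram) : Prop :=
  [\/ first_move c c', second_move c c' | third_move c c'].

Definition same_long_free_knot : chord_diagram -> chord_diagram -> Prop :=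
  clos_refl_sym_trans chord_diagram reidemeister.

(* Main.v *)
(* Each step of the construction depends only on the parity of the number of   *)
(* linked chords in some set of chords, and for a chord {x, y} of the set this *)
(* is one plus the number of ends of the set above x plus the number above y,  *)
(* modulo 2. The letters of the ends are thus the only solution of a system    *)
(* of parity conditions, and for each move a solution before the move yields   *)
(* one after it. In the first two moves the removed ends form adjacent pairs   *)
(* with equal letters, which are involutions of G. In the third move, the      *)
(* parities of a completely adjoint triple sum to zero, so either all three    *)
(* chords lie in a_m or exactly two lie in the same a_k with the third one     *)
(* lying deeper; these two exchange a'_k and a''_k, and the defining relations *)
(* of G give the equality of the words at each of the three adjacent pairs.    *)

Require Import Defs.
From mathcomp Require Import all_boot.
From mathcomp Require Import all_order all_algebra all_fingroup.
From mathcomp Require Import zify.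
From Stdlib Require Import Relation_Operators.

Set Implicit Arguments.
Unset Strict Implicit.
Unset Printing Implicit Defensive.

Import Order.TTheory GRing.Theory Num.Theory.

(** The classes of the chords are characterised without reference to the recursive construction:
    [proper_labelling] imposes local parity conditions on a labelling of the ends. By
    [class_labelling_proper] the classes satisfy them, and by [proper_labelling_unique] nothing else
    does. Hence [w_prod] computes w(c) from any proper labelling, and a move is settled by carrying
    a proper labelling across it and comparing two products.

    Every move comes with an involution f that displaces ends by at most one position, so
    [prod_adjacent] compares products one pair {x, f x} at a time. In the first two moves
    ([w_removal]) f moves exactly the removed ends and preserves labels: each removed pair adds zero
    to every parity and a square, thus 1, to the product.

    In the third move f carries the new chords to the old ones. Conjugating by f changes a parity
    only through the neighbour of the end ([parity_above_twist]). By [two_of_min_depth] the changes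
    cancel, except that the two chords of least depth k < m exchange a'_k and a''_k
    ([third_labelling_proper]). The relations of G, in the form of [letter_elt_swapr] and
    [letter_elt_swap2], absorb this exchange. *)

Section ParityAbove.

(** * Parity of the number of marked ends above a given end *)

Variable N : nat.
Implicit Types (P Q : pred 'I_N) (x y z : 'I_N).

Definition parity_above P x : bool := \big[addb/false]_(z : 'I_N | x < z) P z.

Lemma eq_parity_above P Q : P =1 Q -> parity_above P =1 parity_above Q.
Proof. by move=> PQ x; apply: eq_bigr => z _; apply: PQ. Qed.

Lemma parity_above_succ P x y : y = x.+1 :> nat ->
  parity_above P x = P y (+) parity_above P y.
Proof.
move=> exy; rewrite /parity_above (bigD1 y) /= ?exy //; congr (_ (+) _).
apply: eq_bigl => z; rewrite -val_eqE /=; lia.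
Qed.

Lemma parity_above_neighbour P x y : x = y.+1 :> nat \/ y = x.+1 :> nat ->
  P x = P y -> parity_above P x = P x (+) parity_above P y.
Proof.
move=> [exy|exy] Pxy; last by rewrite (parity_above_succ _ exy) Pxy.
by rewrite (parity_above_succ _ exy) addbA addbb.
Qed.

End ParityAbove.

(** * Involutions that move each position by at most one *)

Section AdjacentInvolution.

Variables (N : nat) (f : 'I_N -> 'I_N).
Hypotheses (fK : involutive f) (f_le : forall x, f x <= x.+1).
Implicit Types (P : pred 'I_N) (x y z : 'I_N).

Lemma adjacent_ge x : x <= (f x).+1.
Proof. by rewrite -{1}[x]fK f_le. Qed.

Lemma adjacent_succ x : f x != x -> x = (f x).+1 :> nat \/ f x = x.+1 :> nat.
Proof. rewrite -val_eqE /= => fx; have := f_le x; have := adjacent_ge x; lia. Qed.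

(** Two positions exchanged by f are consecutive, so no third position lies between them; the order
    can be reversed only inside such a pair. *)
Lemma adjacent_lt x z : (f x < f z) = (x < z) (+) ((z == f x) && (f x != x)).
Proof.
case: eqVneq => [->|nz] /=; first by rewrite fK -val_eqE /=; lia.
have nxz : (f z != x) by apply: contraNneq nz => <-; rewrite fK.
rewrite addbF; move: nz nxz (f_le x) (f_le z) (adjacent_ge x) (adjacent_ge z).
have : (f x == f z) = (x == z) by rewrite (inj_eq (can_inj fK)).
rewrite -!val_eqE /=; lia.
Qed.

(** After reindexing by f, the positions above [f x] pull back to those above x, with the single
    position [f x] toggled when it differs from x ([adjacent_lt]). *)
Lemma parity_above_twist P x :
  parity_above (P \o f) (f x) = parity_above P x (+) ((f x != x) && P (f x)).
Proof.
rewrite /parity_above (reindex_inj (can_inj fK)) /= big_mkcond /=.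
rewrite [in RHS]big_mkcond /=.
transitivity (\big[addb/false]_(z : 'I_N) ((if x < z then P z else false) (+)
    (if z == f x then (f x != x) && P z else false))); last first.
  by rewrite big_split; congr (_ (+) _); rewrite -big_mkcond /= big_pred1_eq.
apply: eq_bigr => z _; rewrite fK adjacent_lt.
by case: (x < z); case: eqP => //= _; case: (f x == x); case: (P z).
Qed.

(** The moved positions of A split into pairs {z, f z}, and each pair contributes P z twice. *)
Lemma parity_moved P (A : pred 'I_N) :
    (forall z, A (f z) = A z) -> (forall z, P (f z) = P z) ->
  \big[addb/false]_(z | A z && (f z != z)) P z = false.
Proof.
move=> Af Pf; rewrite (bigID (fun z : 'I_N => z < f z)) /=.
rewrite [X in _ (+) X](reindex_inj (can_inj fK)) /=.
rewrite [X in _ (+) X](eq_big (fun z : 'I_N => A z && (f z != z) && (z < f z)) P).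
- exact: addbb.
- by move=> z; rewrite Af fK -!val_eqE /=; case: (A z) => //=; lia.
by move=> z _.
Qed.

(** The group is not commutative, so the pairs are peeled off the right end: strong induction on the
    length of a prefix closed under f, whose last position is either fixed or paired with the one
    just before it. *)
Lemma prod_adjacent (gT : groupType) (h h' : 'I_N -> gT) :
    (forall x, f x = x -> h x = h' x) ->
    (forall x, f x = x.+1 :> nat -> (h x * h (f x) = h' x * h' (f x))%g) ->
  (\prod_x h x = \prod_x h' x)%g.
Proof.
move=> hfix hpair.
pose ext (g : 'I_N -> gT) k := if insub k is Some i then g i else 1%g.
have extE g (x : 'I_N) : ext g x = g x by rewrite /ext valK.
have to_nat g : (\prod_x g x = \prod_(0 <= k < N) ext g k)%g.
  by rewrite big_mkord; apply: eq_bigr => i _; rewrite extE.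
rewrite !to_nat.
suff prefix k : k <= N -> (forall x : 'I_N, x < k -> f x < k) ->
    (\prod_(0 <= i < k) ext h i = \prod_(0 <= i < k) ext h' i)%g.
  by apply: prefix.
have [n] := ubnP k; elim: n k => // n IHn [|k] lekn leN closed.
  by rewrite !big_geq.
pose x := Ordinal leN; have fx_le : f x <= k by have := closed x; apply; rewrite /=.
have := adjacent_ge x; rewrite leq_eqVlt => /orP[/eqP ek|/= ltk]; last first.
  have fx : f x = x by apply/val_inj => /=; lia.
  rewrite !big_nat_recr //= -[k]/(val x) !extE hfix //; congr (_ * _)%g => /=.
  apply: IHn; [lia|lia|] => y ltyk; have := closed y; have : f y != x.
    by rewrite -fx (inj_eq (can_inj fK)) -val_eqE /=; lia.
  rewrite -val_eqE /=; lia.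
have [y fy ey] : exists2 y, f y = x & k = y.+1 by exists (f x); rewrite ?fK.
have split g : (\prod_(0 <= i < k.+1) ext g i =
    \prod_(0 <= i < y) ext g i * (g y * g (f y)))%g.
  rewrite big_nat_recr //= -[k in ext g k]/(val x) extE fy mulgA; congr (_ * _)%g.
  have -> : (\prod_(0 <= i < k) ext g i = \prod_(0 <= i < y.+1) ext g i)%g by rewrite -ey.
  by rewrite big_nat_recr //= extE.
rewrite !split hpair ?fy //; congr (_ * _)%g; apply: IHn; [lia|lia|] => z ltzy.
have nzx : f z != x by rewrite -fy (inj_eq (can_inj fK)) -val_eqE /=; lia.
have nzy : f z != y.
  rewrite -[y]fK fy (inj_eq (can_inj fK)) -val_eqE /=; lia.
move: (closed z) nzx nzy; rewrite -!val_eqE /=; lia.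
Qed.

End AdjacentInvolution.

(** * Building such involutions from disjoint transpositions of neighbours *)

Section AdjacentPerm.

Variable N : nat.
Implicit Types (f : {perm 'I_N}) (D : {set 'I_N}) (u x : 'I_N).

Definition adjacent_perm f D :=
  [/\ involutive f, forall x, f x <= x.+1 & forall x, (f x != x) = (x \in D)].

Lemma adjacent_perm1 : adjacent_perm 1 set0.
Proof. by split=> x; rewrite ?perm1 // inE eqxx. Qed.

Lemma adjacent_permM f D u u' : adjacent_perm f D -> u \notin D -> u' \notin D ->
    u = u'.+1 :> nat \/ u' = u.+1 :> nat ->
  adjacent_perm (f * tperm u u')%g ([set u; u'] :|: D).
Proof.
move=> [fK f_le moved] uD u'D uu'.
have fu : f u = u by apply/eqP; rewrite -[_ == _]negbK moved.
have fu' : f u' = u' by apply/eqP; rewrite -[_ == _]negbK moved.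
have nuu' : u' != u by rewrite -val_eqE /=; lia.
have val x : (f * tperm u u')%g x = if x == u then u' else if x == u' then u else f x.
  rewrite permM; case: eqVneq => [->|nxu]; first by rewrite fu tpermL.
  case: eqVneq => [->|nxu']; first by rewrite fu' tpermR.
  by rewrite tpermD // eq_sym -1?[X in _ != X]fu -1?[X in _ != X]fu' (inj_eq perm_inj).
split=> x; rewrite !val ?inE -?moved.
- case: (eqVneq x u) => [->|nxu]; first by rewrite (negbTE nuu') eqxx.
  case: (eqVneq x u') => [->|nxu']; first by rewrite eqxx.
  by rewrite -[in f x == u]fu -[in f x == u']fu' !(inj_eq perm_inj)
    (negbTE nxu) (negbTE nxu') fK.
- case: (eqVneq x u) => [->|nxu]; first lia.
  by case: (eqVneq x u') => [->|nxu']; first lia.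
case: (eqVneq x u) => [->|nxu]; first by rewrite nuu'.
by case: (eqVneq x u') => [->|nxu'] //=; rewrite eq_sym nuu'.
Qed.

End AdjacentPerm.

(** * The letters and their relations in G *)

Section Letters.

Variable m : nat.
Implicit Types (l : letter m) (i j : 'I_m).

(** The stage at which a chord is removed in the construction of the classes; a chord that survives
    all stages gets m. *)
Definition depth l : nat :=
  match l with Prime i => i | DoublePrime i => i | Top => m end.

Definition is_prime l : bool := if l is Prime _ then true else false.

Definition swap_primes l : letter m :=
  match l with
  | Prime i => DoublePrime i | DoublePrime i => Prime i | Top => Top
  end.

Definition letter_elt l : G m := pres_gen (@G_rel m) l.

Lemma depth_le l : depth l <= m.
Proof. by case: l => //= i; apply: ltnW. Qed.

Lemma swap_primesK : involutive swap_primes.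
Proof. by case. Qed.

Lemma depth_swap l : depth (swap_primes l) = depth l.
Proof. by case: l. Qed.

Lemma is_prime_swap l : depth l < m -> is_prime (swap_primes l) = ~~ is_prime l.
Proof. by case: l => //=; rewrite ltnn. Qed.

Lemma letter_ext l l' :
  depth l = depth l' -> (depth l < m -> is_prime l = is_prime l') -> l = l'.
Proof.
case: l l' => [i|i|] [j|j|] //= e h; rewrite ?(val_inj e) //.
- by have := h (ltn_ord i).
- by have := ltn_ord i; rewrite e ltnn.
- by have := h (ltn_ord i).
- by have := ltn_ord i; rewrite e ltnn.
- by have := ltn_ord j; rewrite -e ltnn.
by have := ltn_ord j; rewrite -e ltnn.
Qed.

Lemma G_relE s t : G_rel s t ->
  (\prod_(x <- s) letter_elt x = \prod_(x <- t) letter_elt x :> G m)%g.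
Proof.
move=> st; rewrite -[LHS]/(pres_eval _ s) -[RHS]/(pres_eval _ t) !pres_evalE.
by apply/pres_piP/pres_rel.
Qed.

Lemma letter_elt_sq l : (letter_elt l * letter_elt l = 1)%g.
Proof.
suff /G_relE : G_rel [:: l; l] [::] by rewrite big_nil big_cons big_seq1.
by case: l => [i|i|]; constructor.
Qed.

(** For each kind of l', one choice of l is a defining relation; multiplying it on both sides by the
    involution l' gives the other choice. *)
Lemma letter_elt_swapr l l' : depth l < depth l' ->
  (letter_elt l * letter_elt l' = letter_elt l' * letter_elt (swap_primes l))%g.
Proof.
have rel2 x y z t : G_rel [:: x; y] [:: z; t] ->
    (letter_elt x * letter_elt y = letter_elt z * letter_elt t)%g.
  by move/G_relE; rewrite !big_cons !big_nil !mulg1.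
have conj x y z : (letter_elt x * letter_elt y = letter_elt y * letter_elt z ->
    letter_elt z * letter_elt y = letter_elt y * letter_elt x)%g.
  move=> /(congr1 (fun g => letter_elt y * g * letter_elt y)%g).
  by rewrite !mulgA letter_elt_sq mul1g -!mulgA letter_elt_sq mulg1.
case: l l' => [i|i|] [j|j|] //= ltij; try by have := ltn_ord j; lia.
- by apply: conj; apply: rel2; constructor.
- by apply: conj; apply: rel2; constructor.
- by apply: rel2; constructor.
- by apply: rel2; constructor.
- by apply: rel2; constructor.
by apply: conj; apply: rel2; constructor.
Qed.

(** If the letters agree, both sides are squares, hence 1; otherwise they are a'_i and a''_i, and
    the two sides coincide as words. *)
Lemma letter_elt_swap2 l l' : depth l = depth l' ->
  (letter_elt l * letter_elt l' =
   letter_elt (swap_primes l') * letter_elt (swap_primes l))%g.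
Proof.
case: l l' => [i|i|] [j|j|] //= e; rewrite -?(val_inj e) ?letter_elt_sq //.
- by have := ltn_ord i; rewrite e ltnn.
- by have := ltn_ord i; rewrite e ltnn.
- by have := ltn_ord j; rewrite -e ltnn.
by have := ltn_ord j; rewrite -e ltnn.
Qed.

End Letters.

(** * The classes as the unique solution of parity conditions *)

Section Labellings.

Variables (m N : nat).
Implicit Types (a b : {set chord N}) (p q : chord N) (x y z : 'I_N).
Implicit Types lab : 'I_N -> letter m.

(* By odd_linking, the negated sums are parities of linking numbers; P holds  *)
(* exactly at the ends of the chords of rest a k, respectively of the layer   *)
(* of the chord.                                                              *)
Definition proper_labelling a lab : Prop :=
  forall x y, x != y -> [set x; y] \in a ->
  [/\ lab x = lab y,
      forall k, k < m -> k <= depth (lab x) ->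
        let P z := k <= depth (lab z) in
        (depth (lab x) == k) = ~~ (parity_above P x (+) parity_above P y)
    & depth (lab x) < m ->
        let P z := depth (lab z) == depth (lab x) in
        is_prime (lab x) = ~~ (parity_above P x (+) parity_above P y)].

Lemma mate_exists a x : is_chord_diagram a ->
  exists2 y, x != y & [set x; y] \in a.
Proof.
move=> /andP[/and3P[/eqP cov tr _] /forall_inP card2].
have xcov : x \in cover a by rewrite cov inE.
have /card2/cards2P[u [v [nuv e]]] := pblock_mem xcov.
have := pblock_mem xcov; rewrite e.
have : x \in pblock a x by rewrite mem_pblock.
rewrite e !inE => /orP[]/eqP -> ?; first by exists v.
by exists u; rewrite 1?eq_sym // setUC.
Qed.

Lemma pblock_chord a x p : is_chord_diagram a -> p \in a -> x \in p ->
  pblock a x = p.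
Proof. by move=> /andP[/and3P[_ tr _] _]; apply: def_pblock. Qed.

(** By induction on k, the set of ends of depth at least k is determined: it fixes the parities that
    decide which of them have depth exactly k. The depths then fix the parities that decide the
    primes. *)
Lemma proper_labelling_unique a lab lab' : is_chord_diagram a ->
  proper_labelling a lab -> proper_labelling a lab' -> lab =1 lab'.
Proof.
move=> da prop prop'.
have same k : k <= m -> forall x, (k <= depth (lab x)) = (k <= depth (lab' x)).
  elim: k => // k IHk ltkm x; have [y nxy xya] := mate_exists x da.
  have [_ /(_ k ltkm) cond _] := prop x y nxy xya.
  have [_ /(_ k ltkm) cond' _] := prop' x y nxy xya.
  rewrite ![k < _]ltn_neqAle -!IHk ?(ltnW ltkm) // ![k == _]eq_sym.
  case kx: (k <= _); rewrite ?andbF // !andbT.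
  rewrite cond // cond' -?IHk ?(ltnW ltkm) //; congr (~~ ~~ (_ (+) _));
    by apply: eq_parity_above => z; rewrite IHk // ltnW.
have same_depth x : depth (lab x) = depth (lab' x).
  apply/eqP; rewrite eqn_leq -(same (depth (lab x))) ?depth_le // leqnn.
  by rewrite same ?leqnn ?depth_le.
move=> x; have [y nxy xya] := mate_exists x da.
have [_ _ cond] := prop x y nxy xya; have [_ _ cond'] := prop' x y nxy xya.
apply: letter_ext => // lt; rewrite cond // cond' -?same_depth //.
by congr (~~ (_ (+) _)); apply: eq_parity_above => z; rewrite !same_depth.
Qed.

(** A product of four nonzero integers is negative when an odd number of the factors is. *)
Lemma linked_disjoint x y z t : x != y -> z != t ->
    [disjoint [set x; y] & [set z; t]] ->
  linked [set x; y] [set z; t] =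
  (x < z) (+) (y < z) (+) ((x < t) (+) (y < t)).
Proof.
move=> nxy nzt dis; rewrite linkedE //.
have [nxz nyz nxt nyt] : [/\ x != z, y != z, x != t & y != t].
  move: dis; rewrite disjoint_sym disjoints_subset => /subsetP dis.
  by move: (dis z) (dis t); rewrite !inE !eqxx orbT !negb_or ![z == _]eq_sym
    ![t == _]eq_sym => /(_ isT)/andP[-> ->] /(_ isT)/andP[-> ->].
have sign (u v : 'I_N) : u != v -> (u%:Z - v%:Z != 0)%R && ((u%:Z - v%:Z < 0)%R == (u < v)).
  by rewrite subr_eq0 subr_lt0 eqz_nat ltz_nat eqxx andbT.
have [/andP[xz0 /eqP xz] /andP[yz0 /eqP yz]] := (sign _ _ nxz, sign _ _ nyz).
have [/andP[xt0 /eqP xt] /andP[yt0 /eqP yt]] := (sign _ _ nxt, sign _ _ nyt).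
rewrite !mulr_lt0 !mulf_eq0 !negb_or xz0 yz0 xt0 yt0 xz yz xt yt /=.
by case: (x < z); case: (x < t); case: (y < z); case: (y < t).
Qed.

Lemma linked_self p : linked p p = false.
Proof.
rewrite /linked; case: (set_0Vmem p) => [->|[x xp]]; first by rewrite big_set0.
by rewrite (bigD1 x) //= (bigD1 x xp) /= subrr !mul0r ltxx.
Qed.

(** Summing [linked_disjoint] over the chords of b counts the ends of b above x and above y. The
    chord {x, y} itself would be counted once, since one of its ends is above the other, although it
    is not linked with itself; the term [P x] corrects this. *)
Lemma odd_linking a b x y : is_chord_diagram a -> b \subset a -> x != y ->
    [set x; y] \in a ->
  let P z := pblock a z \in b in
  odd (linking [set x; y] b) =
  P x (+) (parity_above P x (+) parity_above P y).
Proof.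
move=> da sba nxy xya P.
have [/and3P[_ tra _] /forall_inP card2] := andP da.
have trb : trivIset b := trivIsetS sba tra.
have covb z : (z \in cover b) = P z.
  apply/bigcupP/idP => [[q qb zq]|Pz].
    by rewrite /P (pblock_chord da (subsetP sba q qb) zq).
  exists (pblock a z) => //; rewrite mem_pblock.
  by case/and3P: (andP da).1 => /eqP -> *.
have linkE q : q \in b -> linked [set x; y] q =
    (q == [set x; y]) (+) \big[addb/false]_(z in q) ((x < z) (+) (y < z)).
  move=> qb; have qa := subsetP sba q qb.
  have /cards2P[u [v [nuv eq]]] := card2 _ qa.
  case: eqVneq => [->|nq] /=.
    rewrite linked_self big_setU1 ?inE //= big_set1 !ltnn.
    by move: nxy; rewrite -val_eqE /=; case: ltngtP.
  rewrite {2}eq big_setU1 ?inE //= big_set1 eq linked_disjoint // -eq.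
  by move/trivIsetP: tra; apply=> //; rewrite eq_sym.
have -> : odd (linking [set x; y] b) = \big[addb/false]_(q in b) linked [set x; y] q.
  rewrite /linking -sum1_card (big_morph odd oddD (erefl _)) big_mkcond.
  by rewrite [RHS]big_mkcond; apply: eq_bigr => q _; rewrite inE; do 2!case: (_ q).
rewrite (eq_bigr _ linkE) big_split /=; congr (_ (+) _).
  rewrite /P (pblock_chord da xya) ?inE ?eqxx //.
  case: (boolP ([set x; y] \in b)) => [xyb|nb].
    by rewrite (bigD1 _ xyb) /= eqxx big1 // => q /andP[_ /negbTE].
  by rewrite big1 // => q qb; apply/negbTE; apply: contraNneq nb => <-.
rewrite -(big_trivIset _ trb) /= (eq_bigl _ _ covb) big_split /parity_above.
by congr (_ (+) _); rewrite big_mkcond [RHS]big_mkcond; apply: eq_bigr => z _;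
  case: (P z); case: (_ < _).
Qed.

Lemma rest_antimono a j k : j <= k -> rest a k \subset rest a j.
Proof.
elim: k => [|k IHk]; first by rewrite leqn0 => /eqP ->.
rewrite leq_eqVlt => /predU1P[->//|/IHk]; exact: subset_trans (subsetDl _ _).
Qed.

Lemma layerE a k : layer a k = rest a k :\: rest a k.+1.
Proof. by rewrite /= setDDr setDv set0U; apply/esym/setIidPr/odd_chords_sub. Qed.

Lemma mem_rest_depth a p k : p \in a -> k <= m ->
  (p \in rest a k) = (k <= depth (chord_letter m a p)).
Proof.
move=> pa lekm; have := chord_letterP m pa.
have in_layer i : p \in layer a i -> (p \in rest a k) = (k <= i).
  rewrite layerE inE => /andP[nrest pi]; case: leqP => [/(rest_antimono a)|] ltik.
    by rewrite (subsetP ltik).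
  by apply: contraNF nrest; apply/subsetP/rest_antimono.
case: (chord_letter m a p) => [i|i|] /=.
- by move/(subsetP (odd_chords_sub _))/in_layer.
- by rewrite inE => /andP[_ /in_layer].
by move/(subsetP (rest_antimono a lekm)) => ->.
Qed.

Lemma mem_layer_depth a p k : p \in a -> k < m ->
  (p \in layer a k) = (depth (chord_letter m a p) == k).
Proof.
move=> pa ltkm; rewrite layerE in_setD (mem_rest_depth pa ltkm) (mem_rest_depth pa (ltnW ltkm)).
by rewrite -leqNgt -eqn_leq.
Qed.

Definition class_labelling a x := chord_letter m a (pblock a x).

Lemma class_labelling_proper a : is_chord_diagram a ->
  proper_labelling a (class_labelling a).
Proof.
move=> da x y nxy xya; rewrite /class_labelling.
have pin z : pblock a z \in a.
  by apply: pblock_mem; case/and3P: (andP da).1 => /eqP ->; rewrite inE.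
have ex : pblock a x = [set x; y] by apply: pblock_chord; rewrite // !inE eqxx.
have ey : pblock a y = [set x; y] by apply: pblock_chord; rewrite // !inE eqxx orbT.
have sub_a k : rest a k \subset a by apply: (@rest_antimono a 0).
have oddE b : b \subset a -> [set x; y] \in b ->
  odd (linking [set x; y] b) = ~~ (parity_above (fun z => pblock a z \in b) x (+)
    parity_above (fun z => pblock a z \in b) y).
  by move=> ba xyb; rewrite (odd_linking da) //= ex xyb.
rewrite ex ey; split=> // [k ltkm lekd|ltdm].
  have xyk : [set x; y] \in rest a k by rewrite mem_rest_depth // ltnW.
  rewrite -mem_layer_depth // inE xyk /= oddE //.
  by congr (~~ (_ (+) _)); apply: eq_parity_above => z; rewrite mem_rest_depth // ltnW.
have xyl : [set x; y] \in layer a (depth (chord_letter m a [set x; y])).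
  by rewrite mem_layer_depth.
have : is_prime (chord_letter m a [set x; y]) =
    odd (linking [set x; y] (layer a (depth (chord_letter m a [set x; y])))).
  move: ltdm (chord_letterP m xya); case: (chord_letter m a _) => [i|i|] /=.
  - by rewrite inE => _ /andP[_ ->].
  - by rewrite !inE => _ /andP[/nandP[/negP//|/negbTE ->]].
  by rewrite ltnn.
move=> ->; rewrite oddE //; last exact: subset_trans (layer_sub_rest _ _) (sub_a _).
by congr (~~ (_ (+) _)); apply: eq_parity_above => z; rewrite mem_layer_depth.
Qed.

End Labellings.

(** * Invariance under the first and second moves *)

Section Moves.

Variable m : nat.

Lemma prod_enum_ord (gT : groupType) n (h : 'I_n -> gT) :
  (\prod_(x <- enum 'I_n) h x = \prod_x h x)%g.
Proof. by rewrite enumT [index_enum _]unlock. Qed.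

Lemma w_prod (c : chord_diagram) (lab : 'I_(nchords c).*2 -> letter m) :
    proper_labelling (chords c) lab ->
  w m c = (\prod_x letter_elt (lab x))%g.
Proof.
move=> prop; rewrite /w /word /pres_eval big_map prod_enum_ord; apply: eq_bigr => x _.
congr (letter_elt _).
have da := chordsP c; exact: proper_labelling_unique da (class_labelling_proper m da) prop x.
Qed.

(** The surviving ends, the image of the renumbering f, are the fixed points of [phi]. The removed
    ends come in neighbouring pairs with equal labels lying on the same side of any surviving end,
    so the old labels restricted to the survivors remain proper. *)
Lemma w_removal (c' c : chord_diagram) (d : {set chord (nchords c').*2})
    (phi : {perm 'I_(nchords c').*2}) : adjacent_perm phi (cover d) ->
    (forall x, class_labelling m (chords c') (phi x) =
               class_labelling m (chords c') x) ->
  removal d c -> w m c' = w m c.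
Proof.
move=> [phiK phi_le moved] lab_phi [sd [f [f_mono ef]]].
set lab := class_labelling m (chords c') in lab_phi *.
have da' := chordsP c'; have da := chordsP c.
have prop' : proper_labelling (chords c') lab by apply: class_labelling_proper.
have f_inj : injective f.
  move=> x y exy; apply/eqP; rewrite -val_eqE /=.
  by case: ltngtP => // /f_mono; rewrite exy ltnn.
have f_lt x y : (f x < f y) = (x < y).
  case: (ltngtP x y) => [/f_mono->//|/f_mono|/val_inj ->]; last by rewrite ltnn.
  by move=> lt; apply/negbTE; rewrite -leqNgt ltnW.
have f_chord x y : [set x; y] \in chords c -> [set f x; f y] \in chords c' :\: d.
  by move=> xyc; rewrite ef; apply/imsetP; exists [set x; y]; rewrite // imsetU1 imset_set1.
have f_im z : (phi z == z) = (z \in codom f).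
  rewrite -[_ == _]negbK moved; apply/idP/codomP => [|[x ->]].
    have zcov : z \in cover (chords c').
      by case/and3P: (andP da').1 => /eqP ->; rewrite inE.
    move=> zd; have : pblock (chords c') z \in chords c' :\: d.
      rewrite inE pblock_mem // andbT; apply: contra zd => qd.
      by apply/bigcupP; exists (pblock (chords c') z); rewrite // mem_pblock.
    rewrite ef => /imsetP[p _ ep].
    have : z \in pblock (chords c') z by rewrite mem_pblock.
    by rewrite ep => /imsetP[x _ ->]; exists x.
  have [y nxy /f_chord] := mate_exists x da; rewrite inE => /andP[nd fxya].
  apply: contra nd => /bigcupP[q qd fxq].
  rewrite -(pblock_chord da' fxya (x := f x)) ?inE ?eqxx //.
  by rewrite (pblock_chord da' (subsetP sd q qd) fxq).
have above_f (P : pred _) : (forall z, P (phi z) = P z) ->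
    forall x, parity_above (P \o f) x = parity_above P (f x).
  move=> Pphi x; rewrite [RHS]/parity_above (bigID (fun z => phi z != z)) /=.
  have phi_fx : phi (f x) = f x by apply/eqP; rewrite f_im codom_f.
  rewrite (parity_moved phiK) //=; last first.
    by move=> z; rewrite -[in LHS]phi_fx (adjacent_lt phiK phi_le) phi_fx eqxx andbF addbF.
  rewrite (eq_bigl (fun z => z \in f @: [set y : 'I__ | x < y])).
    rewrite big_imset /=; last by move=> ? ? _ _; apply: f_inj.
    by apply: eq_bigl => y; rewrite inE.
  move=> z; rewrite negbK f_im; apply/andP/imsetP => [[ltxz /codomP[y ez]]|[y]].
    by exists y; rewrite // inE -f_lt -ez.
  by rewrite inE => ltxy ->; rewrite f_lt codom_f.
have prop : proper_labelling (chords c) (lab \o f).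
  move=> x y nxy /f_chord; rewrite inE => /andP[_ fxya].
  have [|e1 e2 e3] := prop' _ _ _ fxya; first by rewrite (inj_eq f_inj).
  split=> //= [k ltkm lek|ltm].
    by rewrite e2 // -!above_f // => z; rewrite lab_phi.
  by rewrite e3 // -!above_f // => z; rewrite lab_phi.
rewrite (w_prod prop') (w_prod prop).
(* Each removed pair contributes the square of a letter, so its two factors may be replaced by 1. *)
transitivity (\prod_z (if phi z == z then letter_elt (lab z) else 1))%g.
  apply: (prod_adjacent phiK phi_le) => x px; first by rewrite px eqxx.
  have nx : (phi x == x) = false by rewrite -val_eqE /=; lia.
  by rewrite phiK [x == _]eq_sym nx lab_phi letter_elt_sq mulg1.
have enum_sorted n : sorted (fun i j : 'I_n => i < j) (enum 'I_n).
  by rewrite -(@sorted_map _ _ val ltn) val_enum_ord iota_ltn_sorted.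
have -> : (\prod_x letter_elt ((lab \o f) x) =
    \prod_(z <- [seq f x | x <- enum 'I_(nchords c).*2]) letter_elt (lab z))%g.
  by rewrite big_map prod_enum_ord.
(* The order of the factors matters: both lists are strictly increasing and have the same members,
   hence are equal. *)
have -> : [seq f x | x <- enum 'I_(nchords c).*2] =
    [seq z <- enum 'I_(nchords c').*2 | phi z == z].
  apply: (@irr_sorted_eq _ (fun i j : 'I_ _ => i < j)).
  - by move=> ? ? ?; apply: ltn_trans.
  - by move=> ?; apply: ltnn.
  - exact: homo_sorted (enum_sorted _).
  - by apply: sorted_filter (enum_sorted _) => ? ? ?; apply: ltn_trans.
  by move=> z; rewrite mem_filter mem_enum andbT f_im.
by rewrite big_filter [RHS]big_mkcond prod_enum_ord.
Qed.

Lemma w_first_move c' c : first_move c' c -> w m c' = w m c.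
Proof.
move=> [p [q [pq rem]]]; have da' := chordsP c'.
have pqa : [set p; q] \in chords c' by rewrite (subsetP rem.1) ?inE.
have adj : p = q.+1 :> nat \/ q = p.+1 :> nat by lia.
have cov : [set p; q] :|: set0 = cover [set [set p; q]] by rewrite setU0 /cover big_set1.
have := adjacent_permM (adjacent_perm1 _) (negbT (in_set0 p)) (negbT (in_set0 q)) adj.
rewrite cov mul1g => adjphi; apply: w_removal adjphi _ rem => x.
by rewrite /class_labelling; case: tpermP => // ->;
  rewrite !(pblock_chord da' pqa) ?inE ?eqxx ?orbT.
Qed.

Lemma adjacent_chords_sorted N (b1 b2 : chord N) :
    #|b1| = 2 -> #|b2| = 2 -> adjacent_chords b1 b2 ->
  exists x1 y1 x2 y2 : 'I_N, [/\ x1 < y1 /\ x2 < y2,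
    b1 = [set x1; y1] /\ b2 = [set x2; y2],
    x1 = x2.+1 :> nat \/ x2 = x1.+1 :> nat & y1 = y2.+1 :> nat \/ y2 = y1.+1 :> nat].
Proof.
move=> c1 c2 [p1 [q1 [p2 [q2 [e1 e2 emin emax]]]]].
have sort (p q : 'I_N) (b : chord N) : #|b| = 2 -> b = [set p; q] ->
    exists x y : 'I_N, [/\ x < y, b = [set x; y], minn p q = x & maxn p q = y].
  move=> cb eb; have npq : p != q.
    by apply: contra_eqN cb => /eqP epq; rewrite eb epq setUid cards1.
  case: (ltngtP p q) => [lt|gt|/val_inj/eqP]; last by rewrite (negbTE npq).
    by exists p, q.
  by exists q, p; rewrite setUC.
have [x1 [y1 [lt1 -> emin1 emax1]]] := sort _ _ _ c1 e1.
have [x2 [y2 [lt2 -> emin2 emax2]]] := sort _ _ _ c2 e2.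
move: emin emax; rewrite emin1 emin2 emax1 emax2 => emin emax.
by exists x1, y1, x2, y2; split => //; lia.
Qed.

(** While both chords are present, passing from one to the other changes the parity above each of
    its two ends by one, so the sums agree. The chords are therefore never separated, neither by
    depth nor by primes. *)
Lemma parallel_chords_label N (a : {set chord N}) (lab : 'I_N -> letter m)
    (x1 y1 x2 y2 : 'I_N) : proper_labelling a lab ->
    x1 != y1 -> x2 != y2 -> [set x1; y1] \in a -> [set x2; y2] \in a ->
    x1 = x2.+1 :> nat \/ x2 = x1.+1 :> nat ->
    y1 = y2.+1 :> nat \/ y2 = y1.+1 :> nat ->
  lab x1 = lab x2.
Proof.
move=> prop n1 n2 a1 a2 nbrx nbry.
have [e1 dep1 prime1] := prop _ _ n1 a1; have [e2 dep2 prime2] := prop _ _ n2 a2.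
have above_eq (P : pred 'I_N) : P x1 -> P x2 -> P y1 -> P y2 ->
    parity_above P x1 (+) parity_above P y1 = parity_above P x2 (+) parity_above P y2.
  move=> Px1 Px2 Py1 Py2.
  rewrite (parity_above_neighbour nbrx) ?Px1 // (parity_above_neighbour nbry) ?Py1 //.
  by rewrite addbACA.
(* Both chords are still present at stage k, and if k < m one of them is removed there, so the other
   is too. *)
pose k := minn (depth (lab x1)) (depth (lab x2)).
have edep : depth (lab x1) = depth (lab x2).
  have [ltkm|] := ltnP k m; last first.
    rewrite leq_min => /andP[lt1 lt2]; apply/eqP.
    by rewrite eqn_leq !(leq_trans (depth_le _)).
  have := dep1 k ltkm (geq_minl _ _); have := dep2 k ltkm (geq_minr _ _).
  rewrite /= above_eq -?e1 -?e2 ?geq_minl ?geq_minr // => <-; rewrite /k.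
  by case: (ltngtP (depth (lab x1)) (depth (lab x2))) => //; rewrite ?eqxx ?(eq_sym true);
    case: eqP.
apply: letter_ext => // lt.
have := prime1 lt; have := prime2; rewrite -edep => /(_ lt) /= -> ->.
by rewrite above_eq -?e1 -?e2 ?edep.
Qed.

Lemma w_second_move c' c : second_move c' c -> w m c' = w m c.
Proof.
move=> [b1 [b2 [adj rem]]]; have da' := chordsP c'.
have [sd _] := rem; have [/and3P[_ tra _] /forall_inP card2] := andP da'.
have b1a : b1 \in chords c' by rewrite (subsetP sd) // !inE eqxx.
have b2a : b2 \in chords c' by rewrite (subsetP sd) // !inE eqxx orbT.
have [x1 [y1 [x2 [y2 [[lt1 lt2] [e1 e2] nbrx nbry]]]]] :=
  adjacent_chords_sorted (eqP (card2 _ b1a)) (eqP (card2 _ b2a)) adj.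
have nb : b1 != b2.
  apply/eqP => eb; have : x1 \in b2 by rewrite -eb e1 !inE eqxx.
  have : x2 \in b1 by rewrite eb e2 !inE eqxx.
  by rewrite e1 e2 !inE -!val_eqE /=; lia.
have disj z : z \in b1 -> z \in b2 -> False.
  move=> z1 z2; case/eqP: nb.
  by rewrite -(pblock_chord da' b1a z1) (pblock_chord da' b2a z2).
have n1 : x1 != y1 by rewrite -val_eqE ltn_eqF.
have n2 : x2 != y2 by rewrite -val_eqE ltn_eqF.
rewrite e1 in b1a; rewrite e2 in b2a.
have prop := class_labelling_proper m da'.
have labx := parallel_chords_label prop n1 n2 b1a b2a nbrx nbry.
have [laby1 _ _] := prop _ _ n1 b1a; have [laby2 _ _] := prop _ _ n2 b2a.
have cov : [set y1; y2] :|: ([set x1; x2] :|: set0) = cover [set b1; b2].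
  rewrite /cover bigcup_setU !big_set1 e1 e2; apply/setP => z; rewrite !inE.
  by do 4!case: (z == _).
have y1x : y1 \notin [set x1; x2] :|: set0.
  rewrite !inE orbF negb_or [y1 == _]eq_sym n1 /=; apply/eqP => e.
  by apply: (disj y1); rewrite ?e1 ?e2 !inE -?e eqxx ?orbT.
have y2x : y2 \notin [set x1; x2] :|: set0.
  rewrite !inE orbF negb_or [y2 == x2]eq_sym n2 andbT; apply/eqP => e.
  by apply: (disj y2); rewrite ?e1 ?e2 !inE -?e eqxx ?orbT.
have adjx := adjacent_permM (adjacent_perm1 _) (negbT (in_set0 x1))
  (negbT (in_set0 x2)) nbrx.
have := adjacent_permM adjx y1x y2x nbry.
rewrite cov mul1g => adjphi; apply: w_removal adjphi _ rem => z; rewrite permM.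
have lx t : class_labelling m (chords c') (tperm x1 x2 t) = class_labelling m (chords c') t.
  by case: tpermP => // ->.
have ly t : class_labelling m (chords c') (tperm y1 y2 t) = class_labelling m (chords c') t.
  by case: tpermP => // ->; rewrite -laby1 -laby2.
by rewrite ly lx.
Qed.

End Moves.

(** * Invariance under the third move *)

Section ThirdMove.

Variables (m N : nat) (a T : {set chord N}) (f : {perm 'I_N}).
Hypotheses (da : is_chord_diagram a) (sTa : T \subset a) (cardT : #|T| = 3).
Hypothesis adjf : adjacent_perm f (cover T).
Hypothesis diff_chords :
  forall x, x \in cover T -> pblock a x != pblock a (f x).

(* The chords of T and the pairs {z, f z} alternate around a hexagon.         *)
Lemma hexagon x y : x \in cover T -> x != y -> [set x; y] \in a ->
  exists u, [/\ f x != u, [set f x; u] \in a, f y != f u, [set f y; f u] \in a &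
    {subset cover T <= [:: x; f x; y; f y; u; f u]}].
Proof.
have [fK _ moved] := adjf.
have [/and3P[/eqP cova tra _] /forall_inP card2] := andP da.
have trT : trivIset T := trivIsetS sTa tra.
have covf z : (f z \in cover T) = (z \in cover T).
  by rewrite -!moved fK eq_sym.
have in_pb z : z \in pblock a z by rewrite mem_pblock cova inE.
have pbT z : z \in cover T -> pblock a z \in T.
  by case/bigcupP=> q qT zq; rewrite (pblock_chord da (subsetP sTa q qT) zq).
have pbE z q : q \in T -> z \in q -> pblock a z = q.
  by move=> qT; apply: pblock_chord (subsetP sTa q qT).
have covT z q : q \in T -> z \in q -> z \in cover T.
  by move=> qT zq; apply/bigcupP; exists q.
move=> xT nxy xya; set A := [set x; y].
have xA : x \in A by rewrite !inE eqxx.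
have yA : y \in A by rewrite !inE eqxx orbT.
have pbx : pblock a x = A by apply: pblock_chord.
have AT : A \in T by rewrite -pbx pbT.
have yT := covT y A AT yA.
set B := pblock a (f x); set C := pblock a (f y).
have BT : B \in T by rewrite pbT ?covf.
have CT : C \in T by rewrite pbT ?covf.
have nAB : A != B by rewrite -pbx diff_chords.
have nAC : A != C by rewrite -(pbE y A) // diff_chords.
(* If B = C then B = {f x, f y}, so A and B are closed under f together. The neighbour f z of an end
   z of the third chord D would then lie in none of A, B, D, giving a fourth chord of T. *)
have nBC : B != C.
  apply/eqP => eBC.
  have [D DT nD] : exists2 D, D \in T & D \notin [set A; B].
    apply/subsetPn; apply/negP => /subset_leq_card; rewrite cardT cards2 nAB //.
  have /cards2P[z [z' [_ eD]]] := card2 D (subsetP sTa D DT).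
  have zD : z \in D by rewrite eD !inE eqxx.
  move: nD; rewrite !inE negb_or => /andP[nDA nDB].
  have zT := covT z D DT zD.
  have eB : B = [set f x; f y].
    apply/eqP; rewrite eq_sym eqEcard subUset !sub1set in_pb eBC in_pb /=.
    by rewrite -eBC (eqP (card2 B (subsetP sTa B BT))) cards2 (inj_eq perm_inj) nxy.
  have fz_mem : f z \in pblock a (f z) := in_pb _.
  have nD : pblock a (f z) != D by rewrite -(pbE z D) // eq_sym diff_chords.
  have fzA : f z \notin A.
    apply/negP; rewrite !inE => /orP[/eqP e|/eqP e]; move: nDB; rewrite -(pbE z D) //.
      by rewrite /B -e fK eqxx.
    by rewrite eBC /C -e fK eqxx.
  have fzB : f z \notin B.
    apply/negP; rewrite eB !inE !(inj_eq perm_inj) => zA.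
    by move: nDA; rewrite -(pbE z D) // (pbE z A) ?eqxx // !inE.
  have nE : pblock a (f z) \notin [set A; B].
    rewrite !inE negb_or; apply/andP; split.
      by apply: contra fzA => /eqP <-.
    by apply: contra fzB => /eqP <-.
  have : #|[set A; B] :|: [set D; pblock a (f z)]| <= 3.
    rewrite -cardT subset_leq_card // !subUset !sub1set AT BT DT pbT //.
    by rewrite covf.
  rewrite cardsU cards2 nAB cards2 eq_sym nD /=.
  rewrite (_ : _ :&: _ = set0) ?cards0 //; apply/setP => q; rewrite !inE.
  case: eqVneq => [->|_] /=.
    rewrite eq_sym (negbTE nDA) eq_sym.
    by move: nE; rewrite !inE negb_or => /andP[/negbTE ->].
  case: eqVneq => [->|_] //=; rewrite eq_sym (negbTE nDB) eq_sym.
  by move: nE; rewrite !inE negb_or => /andP[_ /negbTE ->].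
have eT : T = [set A; B; C].
  apply/eqP; rewrite eq_sym eqEcard !subUset !sub1set AT BT CT cardT /=.
  by rewrite setUC cardsU1 cards2 !inE nAB eq_sym (negbTE nAC) eq_sym nBC.
have mate z : z \in cover T -> exists2 u, z != u & pblock a z = [set z; u].
  move=> zT; have [u nzu zua] := mate_exists z da; exists u => //.
  by apply: pblock_chord; rewrite ?inE ?eqxx.
have [u nu eB] : exists2 u, f x != u & B = [set f x; u] by apply: mate; rewrite covf.
have uB : u \in B by rewrite eB !inE eqxx orbT.
have uT : u \in cover T := covT _ _ BT uB.
(* The end f u cannot lie on B, the chord of u, and if it lay on A then u would be f x or f y. *)
have fuC : f u \in C.
  have : pblock a (f u) \in T by rewrite pbT ?covf.
  rewrite eT !inE -orbA => /or3P[]/eqP e; last by rewrite -e.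
    have : f u \in A by rewrite -e.
    rewrite !inE => /orP[]/eqP efu; first by rewrite -efu fK eqxx in nu.
    by case/eqP: nBC; rewrite /C -efu fK (pbE u B).
  by have := diff_chords uT; rewrite e (pbE u B) // eqxx.
have nfu : f y != f u.
  rewrite (inj_eq perm_inj); apply: contraNneq nAB => eyu.
  by rewrite -(pbE y A) // eyu (pbE u B).
have eC : C = [set f y; f u].
  apply/eqP; rewrite eq_sym eqEcard subUset !sub1set in_pb fuC /=.
  by rewrite (eqP (card2 C (subsetP sTa C CT))) cards2 nfu.
exists u; split=> //; rewrite -?eB -?eC ?(subsetP sTa) // => z.
rewrite /cover eT !bigcup_setU !big_set1 eB eC !inE.
by do 6!case: (z == _).
Qed.

Local Notation lab := (class_labelling m a).

Definition min_depth k := forall z, z \in cover T -> k <= depth (lab z).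

Lemma min_depth_attained : exists2 k, min_depth k &
  exists2 z, z \in cover T & depth (lab z) = k.
Proof.
have [z0 z0T] : exists z, z \in cover T.
  have [p pT] : exists p, p \in T by apply/card_gt0P; rewrite cardT.
  have /andP[_ /forall_inP card2] := da.
  have /card_gt0P[z zp] : 0 < #|p| by rewrite (eqP (card2 _ (subsetP sTa p pT))).
  by exists z; apply/bigcupP; exists p.
case: (@arg_minnP _ z0 (fun z => z \in cover T) (fun z => depth (lab z)) z0T) => z zT zmin.
by exists (depth (lab z)) => [t /zmin//|]; exists z.
Qed.

(** At stage k all chords of T are present, so the parities above t and [f t] differ for each end t
    of T. Over the three chords this gives three differences and three negations, an even total; as
    the minimum k is attained, the number of chords of depth k is two. *)
Lemma two_of_min_depth k x y : min_depth k ->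
    (exists2 z, z \in cover T & depth (lab z) = k) -> k < m ->
    x \in cover T -> x != y -> [set x; y] \in a ->
  (depth (lab x) == k) + (depth (lab (f x)) == k) + (depth (lab (f y)) == k) = 2.
Proof.
move=> kmin [z zT zk] ltkm xT nxy xya.
have [u [nu fxua nfu fyua sub]] := hexagon xT nxy xya.
have prop := class_labelling_proper m da.
have [fK f_le moved] := adjf.
have covf t : (f t \in cover T) = (t \in cover T) by rewrite -!moved fK eq_sym.
have mateT s t : s \in cover T -> [set s; t] \in a -> t \in cover T.
  case/bigcupP => q qT sq sta; apply/bigcupP; exists q => //.
  rewrite -(pblock_chord da (subsetP sTa q qT) sq) (pblock_chord da sta) ?inE ?eqxx //.
  by rewrite orbT.
have yT := mateT _ _ xT xya.
have uT : u \in cover T by apply: mateT fxua; rewrite covf.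
pose P t := k <= depth (lab t).
have above_f t : t \in cover T -> parity_above P t = ~~ parity_above P (f t).
  move=> tT; have ft : f t != t by rewrite moved.
  rewrite (parity_above_neighbour (adjacent_succ fK f_le ft)) /P ?kmin ?covf //.
have [exy /(_ k ltkm (kmin _ xT)) /= dx _] := prop _ _ nxy xya.
have fxT : f x \in cover T by rewrite covf.
have fyT : f y \in cover T by rewrite covf.
have [efxu /(_ k ltkm (kmin _ fxT)) /= dfx _] := prop _ _ nu fxua.
have [efyu /(_ k ltkm (kmin _ fyT)) /= dfy _] := prop _ _ nfu fyua.
have even : ((depth (lab x) == k) (+) (depth (lab (f x)) == k)) (+)
    (depth (lab (f y)) == k) = false.
  rewrite dx dfx dfy -/P (above_f x) // (above_f y) // (above_f u) //.
  by do 3!case: (parity_above P _).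
have some : [|| depth (lab x) == k, depth (lab (f x)) == k | depth (lab (f y)) == k].
  have := sub z zT; rewrite !inE -zk => mem; case/or4P: mem => [||| /or3P[]] /eqP ->.
  - by rewrite eqxx.
  - by rewrite eqxx orbT.
  - by rewrite exy eqxx.
  - by rewrite eqxx !orbT.
  - by rewrite efxu eqxx orbT.
  by rewrite efyu eqxx !orbT.
by move: even some; do 3!case: (_ == k).
Qed.

(* For k < m exactly two chords of T have the minimal depth k, and the move   *)
(* exchanges their class with its primed partner; for k = m nothing changes.  *)
Definition third_labelling k z : letter m :=
  if (f z != z) && (depth (lab (f z)) == k) then swap_primes (lab (f z))
  else lab (f z).

Lemma depth_third_labelling k z : depth (third_labelling k z) = depth (lab (f z)).
Proof. by rewrite /third_labelling; case: ifP; rewrite ?depth_swap. Qed.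

Variable a' : {set chord N}.
Hypothesis a'_f : forall x y, [set x; y] \in a' -> [set f x; f y] \in a.

Variable k : nat.
Hypotheses (kmin : min_depth k)
  (kattained : exists2 z, z \in cover T & depth (lab z) = k).

(** For a moved chord, x and y are the neighbours of the ends of the old chord {f x, f y}, so the
    parity corrections come from the other two chords of T. At a stage j up to k both are present;
    if the old chord is present at a later stage, both are already gone; the corrections cancel
    either way. In the parity for primes exactly one of them counts when the old chord has depth k,
    and none when it is deeper. *)
Lemma third_labelling_proper : proper_labelling a' (third_labelling k).
Proof.
move=> x y nxy xya'; have [fK f_le moved] := adjf.
have covf t : (f t \in cover T) = (t \in cover T) by rewrite -!moved fK eq_sym.
have prop := class_labelling_proper m da.
have nfxy : f x != f y by rewrite (inj_eq perm_inj).
have fxya := a'_f xya'; have [elab dep prime] := prop _ _ nfxy fxya.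
have same_cov : (x \in cover T) = (y \in cover T).
  rewrite -[LHS]covf -[RHS]covf.
  have sym s t : [set s; t] \in a -> s \in cover T -> t \in cover T.
    move=> sta /bigcupP[q qT sq]; apply/bigcupP; exists q => //.
    rewrite -(pblock_chord da (subsetP sTa q qT) sq) (pblock_chord da sta) ?inE ?eqxx //.
    by rewrite orbT.
  by apply/idP/idP; apply: sym; rewrite // setUC.
have above_f (Q : pred nat) t :
    parity_above (fun z => Q (depth (third_labelling k z))) t =
    parity_above (fun z => Q (depth (lab z))) (f t) (+)
      ((t \in cover T) && Q (depth (lab t))).
  rewrite -{1}[t]fK (eq_parity_above (Q := (fun z => Q (depth (lab z))) \o f)).
    by rewrite (parity_above_twist fK f_le) fK -moved eq_sym.
  by move=> z; rewrite depth_third_labelling.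
have two : k < m -> x \in cover T ->
    (depth (lab (f x)) == k) + (depth (lab x) == k) + (depth (lab y) == k) = 2.
  move=> ltkm xT; rewrite -[in lab x](fK x) -[in lab y](fK y).
  by apply: two_of_min_depth; rewrite ?covf.
split.
- rewrite /third_labelling !moved same_cov.
  by rewrite elab.
- move=> j ltjm; rewrite !depth_third_labelling => lej /=.
  rewrite (above_f (leq j)) (above_f (leq j)) -same_cov addbACA.
  rewrite dep //=; case xT: (x \in cover T); rewrite ?addbF //=.
  suff -> : (j <= depth (lab x)) = (j <= depth (lab y)) by rewrite addbb addbF.
  have yT : y \in cover T by rewrite -same_cov.
  have := kmin xT; have := kmin yT.
  case: (leqP j k) => [lejk ky kx|ltkj _ _]; first by rewrite !(leq_trans lejk).
  have := two (ltn_trans ltkj ltjm) xT; rewrite gtn_eqF; last exact: leq_trans lej.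
  by case: (eqVneq (depth (lab x)) k) => [->|_]; case: (eqVneq (depth (lab y)) k) => [->|_].
rewrite !depth_third_labelling => ltm /=.
rewrite (above_f (eq_op^~ (depth (lab (f x))))) (above_f (eq_op^~ (depth (lab (f x))))).
rewrite -same_cov addbACA.
rewrite -addNb -[~~ _](prime ltm) /third_labelling moved.
case xT: (x \in cover T) => /=; last by rewrite addbF.
have ltkm : k < m by apply: leq_ltn_trans ltm; apply: kmin; rewrite covf.
have := two ltkm xT; case: eqVneq => [efx|nfxk].
  rewrite efx is_prime_swap ?efx // -addbT.
  by do 2!case: (_ == k).
case: (eqVneq (depth (lab x)) k) => [->|_]; case: (eqVneq (depth (lab y)) k) => [->|_] //.
by rewrite addbb addbF.
Qed.

Lemma prod_third_labelling :
  (\prod_z letter_elt (lab z) = \prod_z letter_elt (third_labelling k z))%g.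
Proof.
have [fK f_le moved] := adjf.
apply: (prod_adjacent fK f_le) => x fx; first by rewrite /third_labelling fx eqxx.
have nfx : f x != x by rewrite -val_eqE /=; lia.
have xT : x \in cover T by rewrite -moved.
have fxT : f x \in cover T by rewrite -moved fK eq_sym.
have [y nxy xya] := mate_exists x da.
have some : (depth (lab x) == k) || (depth (lab (f x)) == k).
  case: (ltnP k m) => [ltkm|lemk].
    by have := two_of_min_depth kmin kattained ltkm xT nxy xya; do 3!case: (_ == k).
  have := kmin xT; have := depth_le (lab x).
  by move=> le1 le2; rewrite eqn_leq le2 (leq_trans le1).
rewrite /third_labelling fK [x == _]eq_sym nfx /=.
case: eqP some => [ex|/eqP nx] /= some; case: eqP some => [efx|/eqP nfxk] //= _.
- by rewrite letter_elt_swap2 // ex.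
- by rewrite letter_elt_swapr // ex ltn_neqAle eq_sym nfxk kmin.
have := @letter_elt_swapr _ (swap_primes (lab (f x))) (lab x).
by rewrite swap_primesK depth_swap => -> //; rewrite efx ltn_neqAle eq_sym nx kmin.
Qed.

End ThirdMove.

Lemma w_third_move m c c' : third_move c c' -> w m c = w m c'.
Proof.
case=> n a a' da da' T r r' s s' t t' S f T' sTa cardT uniq6 covT prs pss pts ea'.
have [[er _] [es _] [et _]] := And3 prs pss pts.
have := uniq6; rewrite /= !inE !negb_or.
case/and5P=> /and5P[nrr' nrs nrs' nrt nrt'] /and4P[nr's nr's' nr't nr't']
  /and3P[nss' nst nst'] /andP[ns't ns't'] /andP[ntt' _].
have adjf : adjacent_perm f (cover T).
  have adjr := adjacent_permM (adjacent_perm1 _) (negbT (in_set0 r))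
    (negbT (in_set0 r')) (or_intror er).
  have nsr : s \notin [set r; r'] :|: set0.
    by rewrite !inE orbF negb_or ![s == _]eq_sym nrs.
  have ns'r : s' \notin [set r; r'] :|: set0.
    by rewrite !inE orbF negb_or ![s' == _]eq_sym nrs'.
  have adjs := adjacent_permM adjr nsr ns'r (or_intror es).
  have nts : t \notin [set s; s'] :|: ([set r; r'] :|: set0).
    by rewrite !inE orbF !negb_or ![t == _]eq_sym nst ns't nrt.
  have nt's : t' \notin [set s; s'] :|: ([set r; r'] :|: set0).
    by rewrite !inE orbF !negb_or ![t' == _]eq_sym nst' ns't' nrt'.
  have := adjacent_permM adjs nts nt's (or_intror et).
  rewrite mul1g -/f (_ : _ :|: _ = cover T) // covT.
  by apply/setP => z; rewrite !inE; do 6!case: (z == _).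
have [fK _ moved] := adjf.
have fr : f r = r' by rewrite !permM tpermL !tpermD // eq_sym.
have fs : f s = s' by rewrite !permM (tpermD nrs nr's) tpermL tpermD // eq_sym.
have ft : f t = t' by rewrite !permM (tpermD nrt nr't) (tpermD nst ns't) tpermL.
have diff_pair x x' : end_pair T x x' -> pblock a x != pblock a x'.
  move=> [_ [b [b' [bT b'T nbb' xb x'b']]]].
  by rewrite (pblock_chord da (subsetP sTa b bT) xb)
    (pblock_chord da (subsetP sTa b' b'T) x'b').
have diff_chords x : x \in cover T -> pblock a x != pblock a (f x).
  rewrite covT !inE -!orbA => /or4P[|||/or3P[]] /eqP ->.
  - by rewrite fr diff_pair.
  - by rewrite -fr fK fr eq_sym diff_pair.
  - by rewrite fs diff_pair.
  - by rewrite -fs fK fs eq_sym diff_pair.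
  - by rewrite ft diff_pair.
  by rewrite -ft fK ft eq_sym diff_pair.
(* Chords outside the triple are untouched because f fixes their ends; for the triple this is the
   definition of [T']. *)
have a'_f x y : [set x; y] \in a' -> [set f x; f y] \in a.
  rewrite ea' inE => /orP[|/imset2P[u v _ + exy]].
    rewrite inE => /andP[nT xya].
    have fix_end z : z \in [set x; y] -> f z = z.
      move=> zxy; apply/eqP; rewrite -[_ == _]negbK moved; apply: contra nT.
      case/bigcupP=> q qT zq.
      by rewrite -(pblock_chord da xya zxy) (pblock_chord da (subsetP sTa q qT) zq).
    by rewrite !fix_end // !inE eqxx ?orbT.
  rewrite inE => /andP[_ fuvT]; apply: (subsetP sTa).
  have -> : [set f x; f y] = f @: [set x; y] by rewrite imsetU1 imset_set1.
  by rewrite exy imsetU1 imset_set1.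
have [k kmin kattained] := min_depth_attained m da sTa cardT.
rewrite (w_prod (c := ChordDiagram da) (class_labelling_proper m da)).
have prop := third_labelling_proper da sTa cardT adjf diff_chords a'_f kmin kattained.
rewrite (w_prod (c := ChordDiagram da') prop).
exact: (prod_third_labelling da sTa cardT adjf diff_chords kmin kattained).
Qed.

Theorem theorem1 (m : nat) (hm : (0 < m)%N) (c1 c2 : chord_diagram) :
  same_long_free_knot c1 c2 -> w m c1 = w m c2 :> G m.
Proof.
elim=> [c c' []| | |].
- exact: w_first_move.
- exact: w_second_move.
- exact: w_third_move.
- by [].
- by move=> x y _ ->.
by move=> x y z _ -> _ ->.
Qed.
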